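(* Let $G=(V,q)$ be a finite connected reversible graph with non-negative Ollivier curvature. Let $f:V\to\mathbb R$ satisfy $\Delta f=-\lambda f$ with $\lambda\ne0$. Then \[ \|\nabla f\|_\infty^2\le\frac{2e\lambda}{q_{\min}}\|f\|_\infty^2. \]
   Context: A graph $G=(V,q)$: $V$ finite, $q:V\times V\to[0,\infty)$; Laplacian $\Delta f(x)=\sum_yq(x,y)(f(y)-f(x))$. Reversible: there is $m:V\to(0,\infty)$ with $q(x,y)m(x)=q(y,x)m(y)$. $d$ is the combinatorial graph distance ($x\sim y$ iff $q(x,y)>0$). $q_{\min}=\min\{q(x,y):q(x,y)>0\}$. $\|f\|_\infty=\max_x|f(x)|$. For $x\ne y$, $\nabla_{xy}f=(f(x)-f(y))/d(x,y)$, $\|\nabla f\|_\infty=\sup_{x\ne y}|\nabla_{xy}f|$. Ollivier curvature $\kappa(x,y)=\inf\{\nabla_{xy}\Delta f:\|\nabla f\|_\infty=1,\ \nabla_{yx}f=1\}$; non-negative means $\kappa(x,y)\ge0$ for all $x\ne y$. *)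

(* Defs.v *)
From Stdlib Require Import Reals.
From mathcomp Require Import all_boot.
Set Implicit Arguments. Unset Strict Implicit. Unset Printing Implicit Defensive.
Local Open Scope R_scope.

Section Graph.
Variable V : finType.
Variable q : V -> V -> R.

Definition adj : rel V := fun x y => if Rlt_dec 0 (q x y) then true else false.

Fixpoint walkb (n : nat) (x y : V) : bool :=
  match n with
  | O => x == y
  | S n' => [exists z, adj x z && walkb n' z y]
  end.

(* combinatorial graph distance: least n with a walk of length n
   (shortest paths have length < #|V| in a connected graph) *)
Definition dist (x y : V) : nat := find (fun n => walkb n x y) (iota 0 #|V|).

Definition connected : Prop := forall x y : V, connect adj x y.

Definition reversible : Prop :=
  exists m : V -> R, (forall x, 0 < m x) /\ (forall x y, q x y * m x = q y x * m y).

Definition lap (f : V -> R) (x : V) : R :=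
  \big[Rplus/0]_(y : V) (q x y * (f y - f x)).

Definition nabla (x y : V) (f : V -> R) : R := (f x - f y) / INR (dist x y).

Definition grad_norm (f : V -> R) : R :=
  \big[Rmax/0]_(x : V) \big[Rmax/0]_(y : V | x != y) Rabs (nabla x y f).

Definition sup_norm (f : V -> R) : R := \big[Rmax/0]_(x : V) Rabs (f x).

Definition qmax : R := \big[Rmax/0]_(x : V) \big[Rmax/0]_(y : V) q x y.
Definition qmin : R :=
  \big[Rmin/qmax]_(x : V) \big[Rmin/qmax]_(y : V | adj x y) q x y.

(* Ollivier curvature kappa(x,y) = inf { nabla_xy (lap f) : ||grad f|| = 1, nabla_yx f = 1 };
   kappa(x,y) >= 0 for all x <> y, i.e. every element of the set is >= 0. *)
Definition ollivier_nonneg : Prop :=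
  forall x y : V, x <> y ->
  forall f : V -> R, grad_norm f = 1 -> nabla y x f = 1 -> 0 <= nabla x y (lap f).

End Graph.

(* Main.v *)
Require Import Defs.
From Stdlib Require Import Reals.
From mathcomp Require Import all_boot.
From Stdlib Require Import Lra Classical.
Set Implicit Arguments. Unset Strict Implicit.
Local Open Scope R_scope.

(** An elliptic maximum principle for two-point functions. Compare
    [f v - f u] with a concave modulus [phi (d u v)]. At a pair [x], [y]
    where [f v - f u - phi (d u v)] is maximal and positive, non-negative
    curvature gives [lap f y - lap f x <= 2 qmin * phi''], the second difference
    appearing because [x] and [y] each jump towards the other at rate at least
    [qmin]. As [lap f = - lam f], this is impossible when
    [2 qmin * (- phi'')] exceeds [2 lam * sup_norm f], so a parabola [phi]
    frozen at height at least [2 * sup_norm f] is a modulus for [f], and the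
    slope of [phi] at [0] bounds the gradient. Any constant
    larger than [4] could replace [2 * exp 1]; the choice
    [2 qmin * (- phi'') = exp 1 * lam * sup_norm f] makes the comparison
    strict because [exp 1 > 2]. *)

(** * Extremal values and sums over finite families *)

Lemma bigRmax_ge (I : eqType) (r : seq I) (P : pred I) (F : I -> R) (a : R) i :
  i \in r -> P i -> F i <= \big[Rmax/a]_(j <- r | P j) F j.
Proof.
elim: r => // j r IH; rewrite inE big_cons => /orP[/eqP <- -> | ir Pi].
  exact: Rmax_l.
by case: (P j); [apply: Rle_trans (IH ir Pi) (Rmax_r _ _) | exact: IH].
Qed.

Lemma bigRmin_le (I : eqType) (r : seq I) (P : pred I) (F : I -> R) (a : R) i :
  i \in r -> P i -> \big[Rmin/a]_(j <- r | P j) F j <= F i.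
Proof.
elim: r => // j r IH; rewrite inE big_cons => /orP[/eqP <- -> | ir Pi].
  exact: Rmin_l.
by case: (P j); [apply: Rle_trans (Rmin_r _ _) (IH ir Pi) | exact: IH].
Qed.

Lemma bigRmax_le (I : Type) (r : seq I) (P : pred I) (F : I -> R) (a c : R) :
  a <= c -> (forall i, P i -> F i <= c) -> \big[Rmax/a]_(j <- r | P j) F j <= c.
Proof.
by move=> ac Fc; elim/big_rec: _ => // i u Pi uc; apply: Rmax_lub => //; exact: Fc.
Qed.

Lemma bigRmin_ge (I : Type) (r : seq I) (P : pred I) (F : I -> R) (a c : R) :
  c <= a -> (forall i, P i -> c <= F i) -> c <= \big[Rmin/a]_(j <- r | P j) F j.
Proof.
by move=> ac Fc; elim/big_rec: _ => // i u Pi uc; apply: Rmin_glb => //; exact: Fc.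
Qed.

Lemma bigRmin_gt (I : Type) (r : seq I) (P : pred I) (F : I -> R) (a c : R) :
  c < a -> (forall i, P i -> c < F i) -> c < \big[Rmin/a]_(j <- r | P j) F j.
Proof.
by move=> ac Fc; elim/big_rec: _ => // i u Pi uc; apply: Rmin_glb_lt => //; exact: Fc.
Qed.

Lemma exists_argmax (T : finType) (x0 : T) (F : T -> R) :
  exists x, forall y, F y <= F x.
Proof.
have [x xP] : exists x, forall y, y \in enum T -> F y <= F x.
  elim: (enum T) => [|a r [x xP]]; first by exists x0.
  case: (Rle_dec (F a) (F x)) => ax; [exists x | exists a] => y;
    rewrite inE => /orP[/eqP -> | /xP]; lra.
by exists x => y; apply: xP; rewrite mem_enum.
Qed.

Lemma sumR_le (I : Type) (r : seq I) (F G : I -> R) :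
  (forall i, F i <= G i) ->
  \big[Rplus/0]_(i <- r) F i <= \big[Rplus/0]_(i <- r) G i.
Proof.
move=> FG; elim/big_ind2: _ => [|u1 u2 v1 v2|i _]; [lra | lra | exact: FG].
Qed.

Lemma sumR_le_add (I : eqType) (r : seq I) (F G : I -> R) i0 c :
  i0 \in r -> (forall i, F i <= G i) -> F i0 + c <= G i0 ->
  \big[Rplus/0]_(i <- r) F i + c <= \big[Rplus/0]_(i <- r) G i.
Proof.
move=> + FG h; elim: r => // j r IH; rewrite inE !big_cons => /orP[/eqP <- | /IH].
  have := @sumR_le _ r _ _ FG; lra.
have := FG j; lra.
Qed.

(** Increments decrease: those after [d] are at most the forward slope at [d], those before are at
    least it. *)
Lemma supertangent (phi : nat -> R) d k :
  (forall n, phi n.+2 - phi n.+1 <= phi n.+1 - phi n) ->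
  phi k <= phi d + (phi d.+1 - phi d) * (INR k - INR d).
Proof.
move=> conc.
have anti m n : phi (m + n).+1 - phi (m + n)%N <= phi m.+1 - phi m.
  by elim: n => [|n IH]; rewrite ?addn0 ?addnS; [lra | have := conc (m + n)%N; lra].
case: (leqP d k) => [/subnKC <- | /ltnW/subnKC <-].
  elim: (k - d)%N => [|j IH]; first by rewrite addn0; lra.
  rewrite addnS S_INR; have := anti d j; lra.
move: (d - k)%N => j; elim: j k => [|j IH] i; first by rewrite addn0; lra.
have := IH i.+1; have := anti i j.+1; rewrite addSnnS S_INR.
have : 0 <= INR (i + j.+1) - INR i - 1.
  by rewrite -plusE plus_INR S_INR; have := pos_INR j; lra.
nra.
Qed.

(** * Graph distance, gradient and minimal rate *)

Section Distance.
Variables (V : finType) (q : V -> V -> R).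
Hypothesis rev : reversible q.
Hypothesis conn : connected q.

Local Notation d := (Defs.dist q).

Lemma adjP x y : reflect (0 < q x y) (adj q x y).
Proof. by rewrite /adj; case: Rlt_dec => h; constructor. Qed.

Lemma adj_sym x y : adj q x y = adj q y x.
Proof.
case: rev => m [m0 mq].
suff h u v : adj q u v -> adj q v u by apply/idP/idP; exact: h.
move=> /adjP uv; apply/adjP.
apply: (Rmult_lt_reg_r (m v)) => //; rewrite Rmult_0_l -mq.
exact: Rmult_lt_0_compat.
Qed.

Lemma walkb_cat m n x y z : walkb q m x y -> walkb q n y z -> walkb q (m + n) x z.
Proof.
elim: m x => [x /eqP -> // | m IH x /= /existsP[u /andP[xu uy]] yz].
by apply/existsP; exists u; rewrite xu IH.
Qed.

Lemma walkb1 x y : walkb q 1 x y = adj q x y.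
Proof.
apply/existsP/idP => [[z /andP[xz /eqP <-]] // | xy].
by exists y; rewrite xy /= eqxx.
Qed.

Lemma walkb_sym n x y : walkb q n x y -> walkb q n y x.
Proof.
elim: n x => [x /= | n IH x /= /existsP[u /andP[xu /IH uy]]]; first by rewrite eq_sym.
have : walkb q (n + 1) y x by apply: walkb_cat uy _; rewrite walkb1 adj_sym.
by rewrite addn1.
Qed.

Lemma walkb_path x p : path (adj q) x p -> walkb q (size p) x (last x p).
Proof.
elim: p x => [x _ /= | a p IH x /= /andP[xa /IH ap]]; first exact: eqxx.
by apply/existsP; exists a; rewrite xa.
Qed.

Lemma dist_le n x y : walkb q n x y -> (d x y <= n)%N.
Proof.
move=> w; rewrite /Defs.dist; set P := fun _ => _; rewrite leqNgt; apply/negP => lt.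
have := before_find 0%N lt; rewrite nth_iota /P ?add0n ?w //.
by apply: leq_trans lt _; rewrite -[X in (_ <= X)%N](size_iota 0); exact: find_size.
Qed.

Lemma walkb_dist x y : walkb q (d x y) x y.
Proof.
have h : has (fun n => walkb q n x y) (iota 0 #|V|).
  (* A duplicate-free path has fewer than [#|V|] steps, so the bounded search in [dist] succeeds. *)
  case/connectP: (conn x y) => p0 /shortenP[p xp up _] ->.
  apply/hasP; exists (size p); last exact: walkb_path.
  by rewrite mem_iota /=; have /card_uniqP := up; move=> /= <-; exact: max_card.
have := nth_find 0%N h; rewrite nth_iota //.
by rewrite -[X in (_ < X)%N](size_iota 0) -has_find.
Qed.

Lemma distxx x : d x x = 0%N.
Proof. by apply/eqP; rewrite -leqn0; apply: dist_le => /=. Qed.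

Lemma dist_gt0 x y : x <> y -> (0 < d x y)%N.
Proof.
rewrite lt0n => xy; apply/eqP => d0; have := walkb_dist x y.
by rewrite d0 => /eqP.
Qed.

Lemma dist_sym x y : d x y = d y x.
Proof. by apply/eqP; rewrite eqn_leq !dist_le //; apply: walkb_sym; exact: walkb_dist. Qed.

Lemma dist_triangle x y z : (d x z <= d x y + d y z)%N.
Proof. by apply: dist_le; apply: walkb_cat (walkb_dist _ _) (walkb_dist _ _). Qed.

Lemma INR_dist_triangle x y z : INR (d x z) <= INR (d x y) + INR (d y z).
Proof. by rewrite -plus_INR; apply/le_INR/leP; exact: dist_triangle. Qed.

Lemma INR_dist_gt0 x y : x <> y -> 0 < INR (d x y).
Proof. by move/dist_gt0/ltP/lt_INR. Qed.

Lemma dist_adj x y : adj q x y -> INR (d x y) <= 1.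
Proof. by rewrite -walkb1 => /dist_le/leP/le_INR. Qed.

Lemma exists_step n x y : d x y = n.+1 -> exists2 z, adj q x z & d z y = n.
Proof.
move=> xy; have := walkb_dist x y; rewrite xy => /existsP[z /andP[xz zy]].
exists z => //; apply/eqP; rewrite eqn_leq dist_le //=.
rewrite -ltnS -xy; apply: leq_trans (dist_triangle x z y) _.
by rewrite -add1n leq_add2r dist_le // walkb1.
Qed.

Lemma grad_norm_le (f : V -> R) c :
  0 <= c -> (forall u v, f v - f u <= c * INR (d u v)) -> grad_norm q f <= c.
Proof.
move=> c0 lip.
apply: bigRmax_le => [|u _]; first lra.
apply: bigRmax_le => [|v /eqP uv]; first lra.
have d0 := INR_dist_gt0 uv.
rewrite /nabla /Rdiv Rabs_mult Rabs_inv [Rabs (INR _)]Rabs_pos_eq; last lra.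
apply: (Rmult_le_reg_r (INR (d u v))) => //.
rewrite Rmult_assoc Rinv_l ?Rmult_1_r; last lra.
apply: Rabs_le; have := lip u v; have := lip v u; rewrite (dist_sym v u); lra.
Qed.

Lemma grad_norm_eq1 (g : V -> R) x y :
  x <> y -> (forall u v, g v - g u <= INR (d u v)) -> nabla q y x g = 1 ->
  grad_norm q g = 1.
Proof.
move=> xy lip yx; apply: Rle_antisym.
  by apply: grad_norm_le => [|u v]; [lra | rewrite Rmult_1_l].
have <- : Rabs (nabla q y x g) = 1 by rewrite yx Rabs_R1.
apply: Rle_trans (bigRmax_ge _ _ (mem_index_enum y) _) => //.
by apply: (bigRmax_ge _ _ (mem_index_enum x)); apply/eqP => /esym.
Qed.

Lemma qmin_le x y : adj q x y -> qmin q <= q x y.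
Proof.
move=> xy; apply: Rle_trans (bigRmin_le _ _ (mem_index_enum x) _) _ => //.
exact: (bigRmin_le _ _ (mem_index_enum y)).
Qed.

Lemma qmin_gt0 x y : adj q x y -> 0 < qmin q.
Proof.
move=> /adjP xy.
(* [qmax] is the default value of both nested minima, so it must be positive too. *)
have M0 : 0 < qmax q.
  apply: Rlt_le_trans xy _.
  apply: Rle_trans (bigRmax_ge _ _ (mem_index_enum x) _) => //.
  exact: (bigRmax_ge _ _ (mem_index_enum y)).
apply: bigRmin_gt => // u _; apply: bigRmin_gt => // v; exact/adjP.
Qed.

(** * Comparison of Laplacians from curvature *)

Hypothesis q0 : forall x y, 0 <= q x y.
Hypothesis curv : ollivier_nonneg q.

(* The infimal convolution of [alpha / s] with the distance is a Lipschitz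
   function squeezed between the two potentials, so curvature, which only
   speaks of one Lipschitz function, applies to the pair [alpha], [beta]. *)
Lemma lap_potentials (alpha beta : V -> R) x y s C :
  0 < s -> x <> y ->
  (forall z w, beta w - alpha z <= C + s * INR (d z w)) ->
  beta y - alpha x = C + s * INR (d x y) ->
  lap q beta y <= lap q alpha x.
Proof.
move=> s0 xy ab abxy.
pose h u z := alpha z / s + INR (d z u).
(* The default [h u x] is itself one of the terms, so [g u] is a true minimum. *)
pose g u := \big[Rmin/h u x]_z h u z.
have g_le u z : g u <= h u z by exact: (bigRmin_le _ _ (mem_index_enum z)).
have g_ge u c : (forall z, c <= h u z) -> c <= g u by move=> cP; exact: bigRmin_ge.
have sh u z : s * h u z = alpha z + s * INR (d z u) by rewrite /h; field; lra.
have lip u v : g v - g u <= INR (d u v).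
  suff : g v - INR (d u v) <= g u by lra.
  apply: g_ge => z; have := g_le v z; have := INR_dist_triangle z u v.
  rewrite /h; lra.
have galpha z : s * g z <= alpha z.
  have := sh z z; rewrite distxx /= Rmult_0_r Rplus_0_r => <-.
  by apply: Rmult_le_compat_l; [lra | exact: g_le].
have gbeta w : beta w - C <= s * g w.
  suff : (beta w - C) / s <= g w.
    move/(Rmult_le_compat_l s _ _ (Rlt_le _ _ s0)).
    by rewrite (_ : s * ((beta w - C) / s) = beta w - C) //; field; lra.
  apply: g_ge => z; apply: (Rmult_le_reg_l s) => //; rewrite sh.
  rewrite (_ : s * ((beta w - C) / s) = beta w - C); last by field; lra.
  have := ab z w; lra.
(* The equality assumed at [x], [y] forces equality in [galpha] at [x], in [gbeta] at [y] and in
   [lip x y]. *)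
have gxy := Rmult_le_compat_l _ _ _ (Rlt_le _ _ s0) (lip x y).
have gx : s * g x = alpha x by have := galpha x; have := gbeta y; lra.
have gy : s * g y = beta y - C by have := galpha x; have := gbeta y; lra.
have d0 := INR_dist_gt0 xy.
have gd : g y - g x = INR (d x y) by apply: (Rmult_eq_reg_l s); lra.
have gyx : nabla q y x g = 1 by rewrite /nabla gd (dist_sym y x); field; lra.
have := curv xy (grad_norm_eq1 xy lip gyx) gyx.
rewrite /nabla => /(Rmult_le_compat_r _ _ _ (Rlt_le _ _ d0)).
rewrite Rmult_0_l /Rdiv Rmult_assoc Rinv_l; last lra.
rewrite Rmult_1_r => lg.
have lg' : s * lap q g y <= s * lap q g x by apply: Rmult_le_compat_l; lra.
have smul u : s * lap q g u = \big[Rplus/0]_v (s * (q u v * (g v - g u))).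
  by apply: (big_morph (fun t => s * t)) => [a b|]; ring.
(* [s * g] touches [beta - C] from above at [y] and [alpha] from below at [x], which orders the
   Laplacians termwise. *)
apply: Rle_trans (Rle_trans _ _ _ _ lg') _; rewrite smul; apply: sumR_le => v.
  have := Rmult_le_compat_l _ _ _ (q0 y v) (gbeta v); nra.
have := Rmult_le_compat_l _ _ _ (q0 x v) (galpha v); nra.
Qed.

(* Moving one point alone towards the other gains more than the supergradient
   [s] of [phi] predicts: replacing the value of [f] at [z0] (resp. [w0]) by
   the prediction keeps the potentials admissible. *)
Lemma lap_concave_modulus (phi : nat -> R) (f : V -> R) x y n :
  (forall k, phi k.+2 - phi k.+1 <= phi k.+1 - phi k) ->
  (forall z w, f w - f z <= phi (d z w)) ->
  d x y = n.+1 -> f y - f x = phi n.+1 -> phi n.+1 < phi n.+2 ->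
  lap q f y + 2 * qmin q * (2 * phi n.+1 - phi n - phi n.+2) <= lap q f x.
Proof.
move=> conc fphi dxy fxy; set s := phi n.+2 - phi n.+1 => s_gt0.
have s0 : 0 < s by rewrite /s; lra.
have xy : x <> y by move=> e; move: dxy; rewrite e distxx.
have tang z w : f w - f z <= phi n.+1 - s * INR n.+1 + s * INR (d z w).
  have := fphi z w; have := supertangent n.+1 (d z w) conc.
  rewrite -/s; lra.
have [z0 xz0 dz0] := exists_step dxy.
have [w0 yw0 dw0] : exists2 w, adj q y w & d w x = n.
  by apply: exists_step; rewrite dist_sym.
have fz0 := fphi z0 y; rewrite dz0 in fz0.
have fw0 := fphi x w0; rewrite dist_sym dw0 in fw0.
have sE : s = phi n.+2 - phi n.+1 by [].
(* The backward slope at [n.+1] is [s + t]. So [f z0 - f x] is at least [s + t], while the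
   supergradient predicts [s]; symmetrically at [w0]. *)
set t := 2 * phi n.+1 - phi n - phi n.+2.
have tE : t = 2 * phi n.+1 - phi n - phi n.+2 by [].
have t0 : 0 <= t by have := conc n; lra.
have qm0 := qmin_gt0 xz0.
have qx := qmin_le xz0; have qy := qmin_le yw0.
have dx := dist_adj xz0; have dy := dist_adj yw0.
pose alpha z := if z == z0 then f x + s else f z.
pose beta w := if w == w0 then f y - s else f w.
have ax : alpha x = f x.
  rewrite /alpha; case: eqP => // e; move: dxy; rewrite e dz0 => /n_Sn [].
have byE : beta y = f y.
  rewrite /beta; case: eqP => // e; move: dxy; rewrite dist_sym e dw0 => /n_Sn [].
have la : lap q alpha x + qmin q * t <= lap q f x.
  rewrite /lap ax; apply: (sumR_le_add (mem_index_enum z0)) => [z|]; last first.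
    have fs : s + t <= f z0 - f x by lra.
    have := Rmult_le_compat_l _ _ _ (q0 x z0) fs.
    have := Rmult_le_compat_r _ _ _ t0 qx; rewrite /alpha eqxx; lra.
  apply: Rmult_le_compat_l => //; rewrite /alpha; case: eqP => [->|_]; lra.
have lb : lap q f y + qmin q * t <= lap q beta y.
  rewrite /lap byE; apply: (sumR_le_add (mem_index_enum w0)) => [w|]; last first.
    have fs : f w0 - f y <= - (s + t) by lra.
    have := Rmult_le_compat_l _ _ _ (q0 y w0) fs.
    have := Rmult_le_compat_r _ _ _ t0 qy; rewrite /beta eqxx; lra.
  apply: Rmult_le_compat_l => //; rewrite /beta; case: eqP => [->|_]; lra.
suff : lap q beta y <= lap q alpha x by lra.
apply: (@lap_potentials _ _ _ _ s (phi n.+1 - s * INR n.+1)) => // [z w|]; last first.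
  by rewrite ax byE dxy; lra.
have sd t1 t2 : t1 <= t2 -> s * t1 <= s * t2 by move=> ?; apply: Rmult_le_compat_l; lra.
(* A replaced value is that of [f] at [x] or [y] shifted by [s]; the shift pays for moving that
   endpoint to its neighbour, at distance at most one. *)
rewrite /alpha /beta; case: eqP => [->|_]; case: eqP => [->|_].
- have := INR_dist_triangle x z0 y; have := INR_dist_triangle z0 w0 y.
  rewrite (dist_sym w0 y) dxy => t1 t2.
  have := sd (INR n.+1) (2 + INR (d z0 w0)); lra.
- have := INR_dist_triangle z w0 y; rewrite (dist_sym w0 y) => t1.
  have := tang z y; have := sd (INR (d z y)) (1 + INR (d z w0)); lra.
- have := INR_dist_triangle x z0 w => t1.
  have := tang x w; have := sd (INR (d x w)) (1 + INR (d z0 w)); lra.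
- exact: tang.
Qed.

End Distance.

(** Clipping the increments at zero freezes the sequence past [mu] and keeps it concave; up to [mu]
    it is [b * n * (2 * mu - n + 1)], with second difference [- 2 * b]. *)
Fixpoint parabola (b mu : R) (n : nat) : R :=
  if n is k.+1 then parabola b mu k + Rmax 0 (2 * b * (mu - INR k)) else 0.

Lemma parabola_incr b mu n :
  parabola b mu n.+1 - parabola b mu n = Rmax 0 (2 * b * (mu - INR n)).
Proof. by rewrite /=; lra. Qed.

Lemma parabola_concave b mu n : 0 < b ->
  parabola b mu n.+2 - parabola b mu n.+1 <= parabola b mu n.+1 - parabola b mu n.
Proof.
move=> b0; rewrite !parabola_incr S_INR; apply: Rle_max_compat_l; nra.
Qed.

Lemma parabola_saturated b mu n : 0 < b -> 0 <= mu -> mu <= INR n ->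
  b * mu ^ 2 <= parabola b mu n.
Proof.
move=> b0 mu0.
have lower k : b * INR k * (2 * mu - INR k + 1) <= parabola b mu k.
  elim: k => [|k IH]; first by rewrite /=; lra.
  rewrite S_INR /=; have := Rmax_r 0 (2 * b * (mu - INR k)); nra.
elim: n => [/= mu_le0|n IH mun].
  have -> : mu = 0 by lra.
  lra.
case: (Rle_dec mu (INR n)) => [/IH le | lt].
  by rewrite /=; have := Rmax_l 0 (2 * b * (mu - INR n)); move: le => /=; lra.
(* Here [S = n + 1] is the first integer not below [mu]; [lower] exceeds [b * mu ^ 2] by
   [b * (S - (S - mu) ^ 2)], and [0 <= S - mu <= 1 <= S]. *)
apply: Rle_trans (lower n.+1); rewrite S_INR in mun *.
have h : 0 <= (INR n + 1 - mu) * (mu - INR n) by apply: Rmult_le_pos; lra.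
nra.
Qed.

(** * Sup norm and sign of the eigenvalue *)

Lemma sup_norm_ge (V : finType) (f : V -> R) x : Rabs (f x) <= sup_norm f.
Proof. exact: (bigRmax_ge _ _ (mem_index_enum x)). Qed.

Lemma sup_norm_ge0 (V : finType) (f : V -> R) : 0 <= sup_norm f.
Proof.
rewrite /sup_norm; elim/big_rec: _ => [|x u _ u0]; first lra.
exact: Rle_trans u0 (Rmax_r _ _).
Qed.

Lemma sup_norm_gt0 (V : finType) (f : V -> R) : 0 < sup_norm f -> exists x, f x <> 0.
Proof.
move=> N0; apply: NNPP => none; have : sup_norm f <= 0; last lra.
apply: bigRmax_le => [|x _]; first lra.
have -> : f x = 0 by apply: NNPP => fx; apply: none; exists x.
rewrite Rabs_R0; lra.
Qed.

(** Maximum principle: where [Rabs (f y)] is largest, the Laplacian has sign opposite to [f y], or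
    vanishes. *)
Lemma eigenvalue_ge0 (V : finType) (q : V -> V -> R) (f : V -> R) lam :
  (forall x y, 0 <= q x y) -> (forall x, lap q f x = - lam * f x) ->
  0 < sup_norm f -> 0 <= lam.
Proof.
move=> q0 eig N0.
have [x fx] := sup_norm_gt0 N0.
have [y yP] := exists_argmax x (fun y => Rabs (f y)).
have fy : 0 < Rabs (f y) by apply: Rlt_le_trans (yP x); exact: Rabs_pos_lt.
move: (eig y); rewrite /lap; case: (Rle_dec 0 (f y)) => sy.
  rewrite Rabs_pos_eq // in yP fy * => E.
  suff : \big[Rplus/0]_v (q y v * (f v - f y)) <= 0 by rewrite E; nra.
  elim/big_rec: _ => [|v u _ u0]; first lra.
  have := yP v; have := Rle_abs (f v); have := q0 y v; nra.
rewrite Rabs_left in yP fy *; last lra.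
move=> E; suff : 0 <= \big[Rplus/0]_v (q y v * (f v - f y)) by rewrite E; nra.
elim/big_rec: _ => [|v u _ u0]; first lra.
have := yP v; have := Rle_abs (- f v); rewrite Rabs_Ropp; have := q0 y v; nra.
Qed.

(** Supplies the edge from which positivity of [qmin] follows. *)
Lemma exists_adj (V : finType) (q : V -> V -> R) (f : V -> R) x :
  (forall x y, 0 <= q x y) -> lap q f x <> 0 -> exists y, adj q x y.
Proof.
move=> q0 lx; case: (pickP (adj q x)) => [y xy | none]; first by exists y.
case: lx; rewrite /lap; elim/big_rec: _ => // y u _ ->.
have -> : q x y = 0; last ring.
by apply: Rle_antisym (q0 x y); apply: Rnot_lt_le => /adjP; rewrite none.
Qed.

Unset Implicit Arguments.

Theorem mainTheorem16 (V : finType) (q : V -> V -> R) (f : V -> R) (lam : R) :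
  (forall x y, 0 <= q x y) ->
  reversible q ->
  connected q ->
  ollivier_nonneg q ->
  lam <> 0 ->
  (forall x, lap q f x = - lam * f x) ->
  (grad_norm q f) ^ 2 <= 2 * exp 1 * lam / qmin q * (sup_norm f) ^ 2.
Proof.
move=> q0 rev conn curv lam_neq0 eig.
have fN u v : f v - f u <= 2 * sup_norm f.
  have := sup_norm_ge f u; have := sup_norm_ge f v.
  have := Rle_abs (f v); have := Rle_abs (- f u); rewrite Rabs_Ropp; lra.
have G0 : 0 <= grad_norm q f.
  rewrite /grad_norm; elim/big_rec: _ => [|x u _ u0]; first lra.
  exact: Rle_trans u0 (Rmax_r _ _).
have [N0|N0] := Rle_lt_or_eq_dec _ _ (sup_norm_ge0 f); last first.
  have G_le0 : grad_norm q f <= 0.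
    by apply: (grad_norm_le rev conn) => [|u v]; [lra | have := fN u v; lra].
  have -> : grad_norm q f = 0 by lra.
  by rewrite -N0; lra.
set N := sup_norm f in fN N0 *.
have lam0 : 0 < lam by have := eigenvalue_ge0 q0 eig N0; lra.
have [x0 fx0] := sup_norm_gt0 N0.
have [y0 xy0] : exists y, adj q x0 y.
  by apply: (exists_adj (f := f)) => //; rewrite eig; nra.
have Q0 := qmin_gt0 xy0.
set Q := qmin q in Q0 *.
have e2 : 2 < exp 1 by have := exp_ineq1 1; lra.
pose b := lam * N * exp 1 / (4 * Q).
have lN0 := Rmult_lt_0_compat _ _ lam0 N0.
have b0 : 0 < b by apply: Rdiv_lt_0_compat; [apply: Rmult_lt_0_compat | ]; lra.
have Qb : 4 * Q * b = lam * N * exp 1 by rewrite /b; field; lra.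
pose mu := sqrt (2 * N / b).
have mu0 : 0 <= mu := sqrt_pos _.
have mu2 : b * mu ^ 2 = 2 * N.
  rewrite pow2_sqrt; first by field; lra.
  by apply/Rlt_le/Rdiv_lt_0_compat; lra.
have modulus u v : f v - f u <= parabola b mu (Defs.dist q u v).
  have [[x y]] := exists_argmax (x0, x0)
    (fun p => f p.2 - f p.1 - parabola b mu (Defs.dist q p.1 p.2)).
  move=> /= xyP; set c := f y - f x - _ in xyP.
  case: (Rle_dec c 0) => c0; first by have := xyP (u, v) => /=; lra.
  case dxy : (Defs.dist q x y) => [|n].
    have e : x = y by apply: NNPP => /(dist_gt0 conn); rewrite dxy.
    by move: c0; rewrite /c e distxx /=; lra.
  have cE : c = f y - f x - parabola b mu n.+1 by rewrite /c dxy.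
  (* At a frozen distance the parabola dominates [f y - f x], against [c > 0]. Hence both increments
     around [n.+1] are unclipped. *)
  have mun : INR n + 1 < mu.
    rewrite -S_INR; apply: Rnot_le_lt => /(parabola_saturated b0 mu0).
    by rewrite mu2; have := fN x y; lra.
  have i1 := parabola_incr b mu n; rewrite Rmax_right in i1; last nra.
  have i2 := parabola_incr b mu n.+1; rewrite S_INR Rmax_right in i2; last nra.
  (* Raising the parabola by the maximal excess [c] gives a modulus attained at [x], [y]. *)
  have : lap q f y + 2 * Q * (2 * b) <= lap q f x.
    rewrite (_ : 2 * b = 2 * (parabola b mu n.+1 + c) - (parabola b mu n + c)
                         - (parabola b mu n.+2 + c)); last by lra.
    apply: (lap_concave_modulus rev conn q0 curv
              (phi := fun k => parabola b mu k + c)) => // [k|z w||].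
    - have := parabola_concave mu k b0; lra.
    - have := xyP (z, w) => /=; lra.
    - lra.
    - nra.
  rewrite !eig.
  have := Rmult_le_compat_l _ _ _ (Rlt_le _ _ lam0) (fN x y).
  have := Rmult_lt_compat_l _ _ _ lN0 e2.
  have : 2 * Q * (2 * b) = lam * N * exp 1 by rewrite -Qb; ring.
  lra.
have G_le : grad_norm q f <= 2 * b * mu.
  apply: (grad_norm_le rev conn) => [|u v]; first nra.
  apply: Rle_trans (modulus u v) _.
  (* The slope at [0] is the first increment, [2 * b * mu]. *)
  have := supertangent 0 (Defs.dist q u v) (fun k => parabola_concave mu k b0).
  rewrite parabola_incr Rmax_right /=; nra.
apply: Rle_trans (pow_incr _ _ 2 (conj G0 G_le)) _.
rewrite (_ : (2 * b * mu) ^ 2 = 4 * b * (b * mu ^ 2)); last by ring.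
by rewrite mu2 /b; right; field; lra.
Qed.
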